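(* Let $A$ be a nonrecursive c.e. set and let $B\equiv_{\rm m} A$. Let $h\colon A\le_{\rm m} B$ and $f\colon B\le_{\rm m} A$ be many-one reductions. Assume there is a c.e. set $K\subseteq \overline A$ such that $f^{-1}(K)$ is infinite and $D_h\setminus(\operatorname{rng}(f)\cup K)$ is finite. Then $A\le_{\rm fo} B$.
   Context: All sets are subsets of $\omega$; $\overline X=\omega\setminus X$. $A\le_{\rm m} B$ via a total computable $h$ means $x\in A\iff h(x)\in B$ for all $x$; $A\equiv_{\rm m}B$ means mutual many-one reducibility. $A\le_{\rm fo} B$ means there is a total computable $g$ with $x\in A\iff g(x)\in B$ for all $x$ and every fibre $g^{-1}(\{y\})$ finite. For a many-one reduction $h\colon A\le_{\rm m}B$, the set of negative duplicates is $D_h:=\{x\in\overline A : (\exists y<x)[\,y\in\overline A \text{ and } h(y)=h(x)\,]\}$. $\operatorname{rng}(f)$ denotes the range of $f$. *)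

(* Defs.v *)
From mathcomp Require Import all_boot.
From mathcomp Require Import boolp classical_sets functions cardinality.

Set Implicit Arguments.
Unset Strict Implicit.
Unset Printing Implicit Defensive.

Local Open Scope classical_set_scope.

(* Kleene's mu-recursive functions: [murec n] is the type of descriptions of
   n-ary partial recursive functions. *)
Inductive murec : nat -> Type :=
| MuZero n : murec n
| MuSucc : murec 1
| MuProj n (i : 'I_n) : murec n
| MuComp k n (a : murec k) (b : 'I_k -> murec n) : murec n
| MuPrec n (a : murec n) (b : murec n.+2) : murec n.+1
| MuMin n (a : murec n.+1) : murec n.

(* [eval e v r] : the function described by [e] is defined at [v], with value
   [r]. In [MuPrec] the recursion is on the first argument and [s] is the
   sequence of intermediate values; in [MuMin] all the values before the least
   zero must be defined. *)
Fixpoint eval n (e : murec n) : n.-tuple nat -> nat -> Prop :=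
  match e in murec n return n.-tuple nat -> nat -> Prop with
  | MuZero _ => fun _ r => r = 0
  | MuSucc => fun v r => r = (thead v).+1
  | MuProj _ i => fun v r => r = tnth v i
  | MuComp k _ a b => fun v r =>
      exists2 w : k.-tuple nat,
        (forall i, eval (b i) v (tnth w i)) & eval a w r
  | MuPrec n a b => fun v r =>
      let u : n.-tuple nat := [tuple of behead v] in
      exists s : nat -> nat,
        [/\ eval a u (s 0),
            forall i, i < thead v ->
              eval b [tuple of [:: i, s i & u]] (s i.+1)
          & r = s (thead v)]
  | MuMin _ a => fun v r =>
      eval a [tuple of r :: v] 0 /\
      forall i, i < r -> exists k, eval a [tuple of i :: v] k.+1
  end.

Lemma eval_functional n (e : murec n) (v : n.-tuple nat) (r1 r2 : nat) :
  eval e v r1 -> eval e v r2 -> r1 = r2.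
Proof.
elim: e v r1 r2 => {n}
  [n|| n i|k n a IHa b IHb|n a IHa b IHb|n a IHa] v r1 r2 /=.
- by move=> -> ->.
- by move=> -> ->.
- by move=> -> ->.
- move=> [w1 bw1 aw1] [w2 bw2 aw2].
  have w12 : w1 = w2 by apply: eq_from_tnth => i; apply: IHb (bw1 i) (bw2 i).
  by move: aw1; rewrite w12 => /IHa; apply.
- move=> [s1 [as1 bs1 ->]] [s2 [as2 bs2 ->]].
  suff s12 i : i <= thead v -> s1 i = s2 i by apply/s12/leqnn.
  elim: i => [|i IHi] lti; first exact: IHa as1 as2.
  move: (bs1 i lti) (bs2 i lti); rewrite (IHi (ltnW lti)); exact: IHb.
- move=> [z1 p1] [z2 p2]; have [/p2|/p1|//] := ltngtP r1 r2.
    by move=> [k] /(IHa _ _ _ z1).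
  by move=> [k] /(IHa _ _ _ z2).
Qed.

Definition computable (f : nat -> nat) : Prop :=
  exists e : murec 1, forall x, eval e [tuple x] (f x).

Definition recursive (A : set nat) : Prop :=
  computable (fun x => nat_of_bool (x \in A)).

Definition ce (A : set nat) : Prop :=
  A = set0 \/ exists2 f : nat -> nat, computable f & A = range f.

Definition reduces_via (h : nat -> nat) (A B : set nat) : Prop :=
  computable h /\ forall x, A x <-> B (h x).

Definition m_reducible (A B : set nat) : Prop :=
  exists h, reduces_via h A B.

Definition m_equivalent (A B : set nat) : Prop :=
  m_reducible A B /\ m_reducible B A.

Definition fo_reducible (A B : set nat) : Prop :=
  exists2 g, reduces_via g A B & forall y, finite_set (g @^-1` [set y]).

Definition negative_duplicates (A : set nat) (h : nat -> nat) : set nat :=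
  [set x | (~` A) x /\ exists y, [/\ y < x, (~` A) y & h y = h x]].

(* Main.v *)
(** Given [x], if [h x] differs from every [h y] with [y < x], or if [x] is one
    of the finitely many exceptional negative duplicates, keep the value [h x].
    Otherwise [x] lies in [A], in [K] or in [range f], and a search finds out
    one of these facts. If [x] is in [A] (resp. [K]), send it to an element of
    [B] (resp. [f @^-1` K]) above [x]; both sets are infinite and c.e. If
    [x = f s], send it to [s]. Each of these rules is finite-one. *)

Require Import Defs.
From mathcomp Require Import all_boot.
From mathcomp Require Import boolp classical_sets functions cardinality.

Local Open Scope classical_set_scope.

(** * Closure properties of computable functions *)

(* Arguments are read off a list with [nth 0], so that adding an argument in
   front of a list [v] is just [i :: v]; only lists of length [n] matter. *)
Definition computes (n : nat) (F : seq nat -> nat) : Prop :=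
  exists e : murec n, forall v : n.-tuple nat, eval e v (F v).

Definition decides (n : nat) (P : seq nat -> bool) : Prop :=
  computes n (fun v => nat_of_bool (P v)).

Lemma eq_computes {n : nat} {F : seq nat -> nat} (G : seq nat -> nat) :
  (forall v : n.-tuple nat, F v = G v) -> computes n F -> computes n G.
Proof. by move=> FG [e eF]; exists e => v; rewrite -FG. Qed.

Lemma computable_computes (f : nat -> nat) :
  computable f <-> computes 1 (fun v => f (nth 0 v 0)).
Proof.
split=> -[e eP]; exists e.
  by case/tupleP=> x w; rewrite (tuple0 w); apply: eP.
by move=> x; apply: (eP [tuple x]).
Qed.

Lemma computes_nth (n i : nat) : i < n -> computes n (fun v => nth 0 v i).
Proof.
move=> lt_in; exists (MuProj (Ordinal lt_in)) => v /=.
by rewrite (tnth_nth 0).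
Qed.

(** [MuComp] needs a family of descriptions indexed by an ordinal type; it is chosen member by
    member from [Hs]. With projections in [Hs], the lemma also permutes, duplicates or drops
    arguments. *)
Lemma computes_subst {n : nat} (Hs : seq (seq nat -> nat)) (G : seq nat -> nat) :
  computes (size Hs) G ->
  (forall i, i < size Hs -> computes n (nth (fun=> 0) Hs i)) ->
  computes n (fun v => G [seq H v | H <- Hs]).
Proof.
move=> [a aG] HsP.
have /choice[b bP] (i : 'I_(size Hs)) :
    exists e : murec n, forall v : n.-tuple nat, eval e v (nth (fun=> 0) Hs i v).
  exact: HsP.
exists (MuComp a b) => v /=; exists (map_tuple (fun H => H (v : seq nat)) (in_tuple Hs)).
  move=> i; have := bP i v.
  by rewrite tnth_map (tnth_nth (fun=> 0)).
exact: aG (map_tuple _ _).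
Qed.

Lemma computes_comp1 {n : nat} {f : nat -> nat} {F : seq nat -> nat} :
  computable f -> computes n F -> computes n (fun v => f (F v)).
Proof.
move=> /computable_computes cf cF.
by apply: (computes_subst [:: F] _ cf) => -[].
Qed.

Lemma computes_comp2 {n : nat} {op : nat -> nat -> nat} {F G : seq nat -> nat} :
  computes 2 (fun v => op (nth 0 v 0) (nth 0 v 1)) ->
  computes n F -> computes n G -> computes n (fun v => op (F v) (G v)).
Proof.
move=> cop cF cG.
by apply: (computes_subst [:: F; G] _ cop) => -[|[]].
Qed.

Lemma computes_succ {n : nat} {F : seq nat -> nat} :
  computes n F -> computes n (fun v => (F v).+1).
Proof. by apply: computes_comp1; exists MuSucc. Qed.

Lemma computes_const (n c : nat) : computes n (fun=> c).
Proof.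
elim: c => [|c IHc]; first by exists (MuZero n).
exact: computes_succ IHc.
Qed.

(** For parameters [u], the sequence [R^~ u] supplies the intermediate values that [MuPrec] asks
    for. *)
Lemma computes_rec {n : nat} {a b : seq nat -> nat} (R : nat -> seq nat -> nat) :
  computes n a -> computes n.+2 b ->
  (forall u, R 0 u = a u) -> (forall i u, R i.+1 u = b [:: i, R i u & u]) ->
  computes n.+1 (fun v => R (nth 0 v 0) (behead v)).
Proof.
move=> [ea eaP] [eb ebP] R0 RS; exists (MuPrec ea eb) => v /=.
exists (R^~ (behead v)); split.
- by rewrite R0; apply: (eaP [tuple of behead v]).
- by move=> i _; rewrite RS; apply: (ebP [tuple of [:: i, R i (behead v) & behead v]]).
- by case/tupleP: v.
Qed.

Lemma computes_add {n : nat} {F G : seq nat -> nat} :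
  computes n F -> computes n G -> computes n (fun v => F v + G v).
Proof.
apply: computes_comp2.
(* [computes_rec] reads its parameters off [behead v], so the second argument is rewritten as the
   head of that list. *)
apply: (eq_computes (F := fun v => nth 0 v 0 + nth 0 (behead v) 0)).
  by move=> v; rewrite nth_behead.
exact: (computes_rec (fun i u => i + nth 0 u 0) (computes_nth 1 0 isT)
          (computes_succ (computes_nth 3 1 isT))).
Qed.

Lemma computes_mul {n : nat} {F G : seq nat -> nat} :
  computes n F -> computes n G -> computes n (fun v => F v * G v).
Proof.
apply: computes_comp2.
apply: (eq_computes (F := fun v => nth 0 v 0 * nth 0 (behead v) 0)).
  by move=> v; rewrite nth_behead.
exact: (computes_rec (fun i u => i * nth 0 u 0) (computes_const 1 0)
          (computes_add (computes_nth 3 2 isT) (computes_nth 3 1 isT))).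
Qed.

Lemma computes_pred {n : nat} {F : seq nat -> nat} :
  computes n F -> computes n (fun v => (F v).-1).
Proof.
apply/computes_comp1/computable_computes.
exact: (computes_rec (fun i _ => i.-1) (computes_const 0 0) (computes_nth 2 0 isT)).
Qed.

Lemma computes_sub {n : nat} {F G : seq nat -> nat} :
  computes n F -> computes n G -> computes n (fun v => F v - G v).
Proof.
(* The recursion is on the first argument, so the subtrahend has to come first. *)
move=> cF cG; move: cG cF; apply: (computes_comp2 (op := fun x y => y - x)).
apply: (eq_computes (F := fun v => nth 0 (behead v) 0 - nth 0 v 0)).
  by move=> v; rewrite nth_behead.
apply: (computes_rec (fun i u => nth 0 u 0 - i) (computes_nth 1 0 isT)
          (computes_pred (computes_nth 3 1 isT))) => [u|i u] /=.
  exact: subn0.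
exact: subnS.
Qed.

(** * Decidable predicates and bounded quantification *)

Lemma decides_neg {n : nat} {P : seq nat -> bool} :
  decides n P -> decides n (fun v => ~~ P v).
Proof.
move=> dP; apply: eq_computes (computes_sub (computes_const n 1) dP) => v.
by case: (P v).
Qed.

Lemma decides_and {n : nat} {P Q : seq nat -> bool} :
  decides n P -> decides n Q -> decides n (fun v => P v && Q v).
Proof.
move=> dP dQ; apply: eq_computes (computes_mul dP dQ) => v.
by rewrite mulnb.
Qed.

Lemma decides_or {n : nat} {P Q : seq nat -> bool} :
  decides n P -> decides n Q -> decides n (fun v => P v || Q v).
Proof.
move=> dP dQ.
apply: eq_computes (decides_neg (decides_and (decides_neg dP) (decides_neg dQ))) => v.
by rewrite negb_and !negbK.
Qed.

Lemma decides_leq {n : nat} {F G : seq nat -> nat} :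
  computes n F -> computes n G -> decides n (fun v => F v <= G v).
Proof.
move=> cF cG.
apply: eq_computes (computes_sub (computes_const n 1) (computes_sub cF cG)) => v.
by rewrite -subn_eq0; case: (F v - G v).
Qed.

Lemma decides_eq {n : nat} {F G : seq nat -> nat} :
  computes n F -> computes n G -> decides n (fun v => F v == G v).
Proof.
move=> cF cG.
apply: eq_computes (decides_and (decides_leq cF cG) (decides_leq cG cF)) => v.
by rewrite eqn_leq.
Qed.

Lemma decides_in {n : nat} (s : seq nat) {F : seq nat -> nat} :
  computes n F -> decides n (fun v => F v \in s).
Proof.
move=> cF; elim: s => [|c s IHs]; first exact: computes_const n 0.
exact: decides_or (decides_eq cF (computes_const n c)) IHs.
Qed.

Lemma computes_if {n : nat} {P : seq nat -> bool} {F G : seq nat -> nat} :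
  decides n P -> computes n F -> computes n G ->
  computes n (fun v => if P v then F v else G v).
Proof.
move=> dP cF cG.
apply: eq_computes (computes_add (computes_mul dP cF)
                                 (computes_mul (decides_neg dP) cG)) => v.
by case: (P v); rewrite mul1n mul0n ?addn0.
Qed.

(** Primitive recursion on the bound: the value at [i.+1] is the disjunction of the value at [i] and
    the truth value of [P] at [i]. *)
Lemma decides_has {n : nat} {P : seq nat -> bool} :
  decides n.+1 P ->
  decides n.+1 (fun v => has (fun i => P (i :: behead v)) (iota 0 (nth 0 v 0))).
Proof.
move=> dP.
pose b v := nat_of_bool ((nth 0 v 1 != 0) || P (nth 0 v 0 :: drop 2 v)).
have cb : computes n.+2 b.
  have d1 := decides_neg (decides_eq (computes_nth n.+2 1 isT) (computes_const _ 0)).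
  apply: (decides_or (Q := fun v => P (nth 0 v 0 :: drop 2 v)) d1).
  (* The step function receives the index, the previous value and the parameters. These projections
     skip position 1, the previous value, and so leave the arguments of [P]. *)
  pose Hs := [seq (fun v => nth 0 v (if i is 0 then 0 else i.+1)) | i <- iota 0 n.+1] :
    seq (seq nat -> nat).
  have szHs : size Hs = n.+1 by rewrite size_map size_iota.
  have := computes_subst (n := n.+2) Hs (fun v => nat_of_bool (P v)).
  rewrite szHs => /(_ dP) cHs; apply: eq_computes (cHs _) => [v|i lti].
    congr (nat_of_bool (P _)); rewrite -map_comp /=; congr cons.
    apply: (@eq_from_nth _ 0) => [|i].
      by rewrite size_map size_iota size_drop size_tuple subn2.
    rewrite size_map size_iota => lti.
    by rewrite (nth_map 0) ?size_iota // nth_iota // nth_drop /= add1n.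
  rewrite (nth_map 0) ?size_iota // nth_iota //.
  by apply: computes_nth; case: i lti.
apply: (computes_rec (fun i u => nat_of_bool (has (fun j => P (j :: u)) (iota 0 i)))
          (computes_const n 0) cb) => // i u.
rewrite -[i.+1]addn1 iotaD has_cat /b /= orbF drop0 add0n.
by case: (has _ _).
Qed.

(** * Unbounded search *)

Lemma computes_min {n : nat} {P : seq nat -> bool} {F : seq nat -> nat} :
  decides n.+1 P ->
  (forall v : n.-tuple nat, P (F v :: v) /\ forall i, i < F v -> ~~ P (i :: v)) ->
  computes n F.
Proof.
(* [MuMin] looks for a zero, so it is given the negation of [P], whose value is 1 at all smaller
   arguments. *)
move=> /decides_neg [e eP] FP; exists (MuMin e) => v /=; have [Pv minF] := FP v.
split; first by have := eP [tuple of F v :: v]; rewrite /= Pv.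
move=> i ltiF; exists 0; have := eP [tuple of i :: v].
by rewrite /= minF.
Qed.

Lemma computable_search {P : nat -> nat -> bool} :
  decides 2 (fun v => P (nth 0 v 0) (nth 0 v 1)) ->
  (forall x, exists s, P s x) ->
  exists2 m : nat -> nat, computable m & forall x, P (m x) x.
Proof.
move=> dP exP; exists (fun x => ex_minn (exP x)); last by move=> x; case: ex_minnP.
apply/computable_computes/(computes_min dP).
case/tupleP=> x w /=; case: ex_minnP => s Ps mins; split=> // i lti.
by apply/negP=> /mins; rewrite leqNgt lti.
Qed.

(** * Reductions *)

Lemma infinite_nat_gt {C : set nat} (x : nat) :
  infinite_set C -> exists2 n, x < n & C n.
Proof.
move=> infC; apply: contrapT => noC; apply: infC.
apply: (sub_finite_set _ (finite_II x.+1)) => n Cn /=.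
by rewrite ltnS leqNgt; apply/negP => ltxn; apply: noC; exists n.
Qed.

(** To decide [A] at [x], look up [h x] in a finite list of the elements of [B]. *)
Lemma reduces_via_finite_recursive {A B : set nat} {h : nat -> nat} :
  reduces_via h A B -> finite_set B -> recursive A.
Proof.
move=> [ch hP] /finite_seqP[s sB]; apply/computable_computes.
apply: eq_computes (decides_in s (computes_comp1 ch (computes_nth 1 0 isT))) => v.
congr nat_of_bool; apply/idP/idP => [hs|/set_mem /hP].
  by apply/mem_set/hP; rewrite sB.
by rewrite sB.
Qed.

(** Membership in [range c] is only enumerable, so a search must range over both the candidate [n]
    and the stage [t] with [c t = f n]. A first search finds a common bound [N x] for both; under
    this bound the condition on [n] is decidable, and a second search finds [n]. *)
Lemma infinite_preimage_above {f c : nat -> nat} :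
  computable f -> computable c -> infinite_set (f @^-1` range c) ->
  exists2 e : nat -> nat, computable e & forall x, x < e x /\ range c (f (e x)).
Proof.
move=> cf cc inf_fc.
pose Q N n x := (x < n) && has (fun t => c t == f n) (iota 0 N).
have dQ : decides 3 (fun v => Q (nth 0 v 0) (nth 0 v 1) (nth 0 v 2)).
  apply: decides_and.
    exact: decides_leq (computes_succ (computes_nth 3 2 isT)) (computes_nth 3 1 isT).
  apply: eq_computes (decides_has (decides_eq (computes_comp1 cc (computes_nth 3 0 isT))
                         (computes_comp1 cf (computes_nth 3 1 isT)))) => v.
  by rewrite /= nth_behead.
have [N cN NP] : exists2 N, computable N &
    forall x, has (fun n => Q (N x) n x) (iota 0 (N x)).
  apply: (@computable_search (fun N x => has (fun n => Q N n x) (iota 0 N))).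
    (* [decides_has] quantifies over the first argument, so [n] is moved in front of [N]; below, [N]
       is passed twice, as the bound and as a parameter. *)
    pose P v := Q (nth 0 v 1) (nth 0 v 0) (nth 0 v 2).
    have dP : decides 3 P.
      apply: (computes_subst [:: nth 0^~ 1; nth 0^~ 0; nth 0^~ 2] _ dQ).
      by move=> [|[|[|]]] // _; apply: computes_nth.
    apply: (computes_subst [:: nth 0^~ 0; nth 0^~ 0; nth 0^~ 1] _ (decides_has dP)).
    by move=> [|[|[|]]] // _; apply: computes_nth.
  move=> x; have [n ltxn [t _ ctn]] := infinite_nat_gt x inf_fc.
  exists (maxn n t).+1; apply/hasP; exists n.
    by rewrite mem_iota /= ltnS leq_maxl.
  rewrite /Q ltxn; apply/hasP; exists t; last exact/eqP.
  by rewrite mem_iota /= ltnS leq_maxr.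
have [e ce eP] : exists2 e, computable e & forall x, Q (N x) (e x) x.
  apply: (@computable_search (fun n x => Q (N x) n x)) => [|x].
    apply: (computes_subst [:: fun v => N (nth 0 v 1); nth 0^~ 0; nth 0^~ 1] _ dQ).
    move=> [|[|[|]]] // _; try exact: computes_nth.
    exact: (computes_comp1 cN (computes_nth 2 1 isT)).
  by have /hasP[n _ Qn] := NP x; exists n.
exists e => // x; have /andP[ltx /hasP[t _ /eqP ct]] := eP x.
by split=> //; exists t.
Qed.

Theorem theorem2p4 (A B : set nat)
  (A_nonrecursive : ~ recursive A) (A_ce : ce A)
  (BA : m_equivalent B A)
  (h f : nat -> nat)
  (h_red : reduces_via h A B) (f_red : reduces_via f B A)
  (HK : exists K : set nat,
    [/\ ce K, K `<=` ~` A, infinite_set (f @^-1` K)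
      & finite_set (negative_duplicates A h `\` (range f `|` K))]) :
  fo_reducible A B.
Proof.
have infB : infinite_set B.
  by move=> finB; apply: A_nonrecursive (reduces_via_finite_recursive h_red finB).
have [[ch hP] [cf fP]] := (h_red, f_red).
have preA : f @^-1` A = B by apply/seteqP; split=> x /fP.
have [K [K_ce KA infK /finite_seqP[s sP]]] := HK.
case: A_ce => [A0|[a ca Aa]].
  by case: infB; rewrite -preA A0 preimage_set0; apply: finite_set0.
case: K_ce => [K0|[k ck Kk]].
  by case: infK; rewrite K0 preimage_set0; apply: finite_set0.
rewrite -preA Aa in infB; rewrite Kk in infK.
have [eA ceA eAP] := infinite_preimage_above cf ca infB.
have [eK ceK eKP] := infinite_preimage_above cf ck infK.
(* Here [s] lists the negative duplicates outside [range f] and [K]. *)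
pose keep x := ~~ has (fun y => h y == h x) (iota 0 x) || (x \in s).
have dkeep n F : computes n F -> decides n (fun v => keep (F v)).
  apply: (computes_comp1 (f := fun x => nat_of_bool (keep x))).
  apply/computable_computes.
  have dh := decides_has (decides_eq (computes_comp1 ch (computes_nth 2 0 isT))
                                     (computes_comp1 ch (computes_nth 2 1 isT))).
  have drepeat :
      decides 1 (fun v => has (fun y => h y == h (nth 0 v 0)) (iota 0 (nth 0 v 0))).
    apply: (computes_subst [:: nth 0^~ 0; nth 0^~ 0] _ dh).
    by move=> [|[|]] // _; apply: computes_nth.
  exact: decides_or (decides_neg drepeat) (decides_in s (computes_nth 1 0 isT)).
(* One index [t] runs through the three enumerations at once, and the search stops immediately when
   [keep x] holds. *)
have [m cm mP] : exists2 m, computable m &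
    forall x, [|| keep x, a (m x) == x, k (m x) == x | f (m x) == x].
  apply: (@computable_search (fun t x => [|| keep x, a t == x, k t == x | f t == x])).
    have [v0 v1] := (computes_nth 2 0 isT, computes_nth 2 1 isT).
    apply: decides_or (dkeep _ _ v1) _.
    apply: decides_or (decides_eq (computes_comp1 ca v0) v1) _.
    apply: decides_or (decides_eq (computes_comp1 ck v0) v1) _.
    exact: decides_eq (computes_comp1 cf v0) v1.
  move=> x; have [|nkeep] /= := boolP (keep x); first by exists 0.
  have [Ax|nAx] := pselect (A x).
    by move: Ax; rewrite Aa => -[t _ <-]; exists t; rewrite eqxx.
  have [Kx|nKx] := pselect (K x).
    by move: Kx; rewrite Kk => -[t _ <-]; exists t; rewrite eqxx orbT.
  have [[t _ <-]|nfx] := pselect (range f x); first by exists t; rewrite eqxx !orbT.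
  (* Otherwise [x] repeats the value of [h] at some [y < x]. As [h y = h x] is outside [B], also [y]
     is outside [A], so [x] is an exceptional negative duplicate and belongs to [s]. *)
  case/norP: nkeep => /negPn /hasP[y]; rewrite mem_iota => /= ltyx /eqP hyx.
  case/negP; suff : [set` s] x by [].
  rewrite -sP; split; last by case.
  by split=> //; exists y; split=> // Ay; apply/nAx/hP; rewrite -hyx; apply/hP.
pose g x := if keep x then h x else if a (m x) == x then eA x
            else if k (m x) == x then eK x else m x.
exists g.
  split.
    apply/computable_computes; have v0 := computes_nth 1 0 isT.
    have cmv := computes_comp1 cm v0.
    apply: computes_if (dkeep _ _ v0) (computes_comp1 ch v0) _.
    apply: computes_if (decides_eq (computes_comp1 ca cmv) v0) (computes_comp1 ceA v0) _.
    exact: computes_if (decides_eq (computes_comp1 ck cmv) v0) (computes_comp1 ceK v0) cmv.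
  move=> x; rewrite /g; have := mP x; case: ifP => // _ /=.
  have [ax _|_] := eqVneq (a (m x)) x.
    have [_ eAx] := eAP x; split=> _; first by apply/fP; rewrite Aa.
    by rewrite Aa; exists (m x).
  have [kx _|_ /= /eqP fx] := eqVneq (k (m x)) x; last by rewrite -{1}fx; split=> /fP.
  (* Both sides are false: [x] and [f (eK x)] lie in [K], which is disjoint from [A]. *)
  have [_ eKx] := eKP x; split=> [Ax|/fP Afx].
    by case: (KA x) => //; rewrite Kk; exists (m x).
  by case: (KA (f (eK x))) => //; rewrite Kk.
move=> y.
(* At most one point: the least element of the fibre of [h] over [y]. *)
pose fresh := [set x | h x = y /\ forall z, z < x -> h z <> h x].
have fin_fresh : finite_set fresh.
  have [[x0 [hx0 x0min]]|none] := pselect (exists x, fresh x); last first.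
    by apply: (sub_finite_set _ (finite_set0 nat)) => x fx; apply: none; exists x.
  apply: (sub_finite_set _ (finite_set1 x0)) => x [hx xmin] /=.
  have [/x0min|/xmin|//] := ltngtP x x0; by rewrite hx hx0.
(* The four sets cover the rules in turn: kept first occurrences, kept exceptions, values of [eA] or
   [eK] (which exceed [x], so [x < y]), and [m x = y], which forces [x = f y]. *)
apply: (sub_finite_set (B := fresh `|` [set` s] `|` `I_y `|` [set f y])); last first.
  rewrite !finite_setU; do !split=> //; exact: finite_set1.
move=> x /=; rewrite /g; have := mP x; case: ifP => [/orP[/hasPn xmin|xs] _ hx|_ /=].
- left; left; left; split=> // z ltzx; apply/eqP/xmin.
  by rewrite mem_iota.
- by left; left; right.
have [_ _ <-|_] := eqVneq (a (m x)) x; first by left; right; have [] := eAP x.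
have [_ _ <-|_ /= /eqP fx <-] := eqVneq (k (m x)) x; last by right.
by left; right; have [] := eKP x.
Qed.
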